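(* Let $B$ be a topological space and let $f,g,h:X\to Y$ be fibrewise maps between fibrewise spaces over $B$, where $X$ is a normal space. Then $$D_B(f,g)\le D_B(f,h)+D_B(h,g).$$
   Context: Fix a topological space $B$ and let $I=[0,1]$. A fibrewise space over $B$ is a topological space $X$ with a continuous map $p_X:X\to B$; a fibrewise map $f:X\to Y$ is a continuous map with $p_Y\circ f=p_X$. A subspace $U\subset X$ is a fibrewise space via $p_X|_U$. Two fibrewise maps $f,g:X\to Y$ are fibrewise homotopic, $f\simeq_B g$, if there is a continuous $H:X\times I\to Y$ with $H(x,0)=f(x)$, $H(x,1)=g(x)$ and $p_Y(H(x,t))=p_X(x)$ for all $x,t$. Parametrized homotopic distance: for fibrewise maps $f,g:X\to Y$, $D_B(f,g)$ is the smallest integer $n\ge 0$ such that $X$ has an open cover $\{U_0,\dots,U_n\}$ with $f|_{U_i}\simeq_B g|_{U_i}$ for all $i$; it is $\infty$ if no such $n$ exists. *)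

(* Defs.v *)
From HB Require Import structures.
From mathcomp Require Import all_boot all_order all_algebra.
From mathcomp Require Import all_classical all_reals all_analysis.

Set Implicit Arguments.
Unset Strict Implicit.
Unset Printing Implicit Defensive.

Import Order.TTheory GRing.Theory Num.Theory.
Import numFieldNormedType.Exports.

Local Open Scope classical_set_scope.
Local Open Scope ring_scope.

(* A fibrewise space over B is given unbundled, as a topological space X
   together with its projection pX : X -> B. *)
Definition fibrewise_map (B X Y : topologicalType) (pX : X -> B) (pY : Y -> B)
    (f : X -> Y) : Prop :=
  continuous f /\ pY \o f = pX.

(* Coerced to a type, this set carries the subspace topology inherited
   from R. *)
Definition unit_interval (R : realType) : set R := `[0, 1]%classic.

Arguments unit_interval R : clear implicits.

Lemma unit_interval0 (R : realType) : 0 \in unit_interval R.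
Proof. by apply: mem_set; rewrite /unit_interval /= in_itv /= lexx ler01. Qed.

Lemma unit_interval1 (R : realType) : 1 \in unit_interval R.
Proof. by apply: mem_set; rewrite /unit_interval /= in_itv /= lexx ler01. Qed.

Definition itv_start (R : realType) : unit_interval R :=
  exist _ 0 (unit_interval0 R).

Definition itv_end (R : realType) : unit_interval R :=
  exist _ 1 (unit_interval1 R).

Definition fibrewise_homotopic (R : realType) (B X Y : topologicalType)
    (pX : X -> B) (pY : Y -> B) (f g : X -> Y) : Prop :=
  exists H : X * unit_interval R -> Y,
    [/\ continuous H,
        forall x, H (x, itv_start R) = f x,
        forall x, H (x, itv_end R) = g x
      & forall x t, pY (H (x, t)) = pX x].

(* The subset U is used as a topological space in its own right, with the
   subspace topology; set_val : U -> X is the inclusion, so that composing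
   with it is restriction to U. *)
Definition fibrewise_homotopic_on (R : realType) (B X Y : topologicalType)
    (pX : X -> B) (pY : Y -> B) (f g : X -> Y) (U : set X) : Prop :=
  @fibrewise_homotopic R B U Y
    (pX \o set_val) pY (f \o set_val) (g \o set_val).

Definition homotopic_cover (R : realType) (B X Y : topologicalType)
    (pX : X -> B) (pY : Y -> B) (f g : X -> Y) (n : nat) : Prop :=
  exists U : 'I_n.+1 -> set X,
    [/\ forall i, open (U i),
        \bigcup_i U i = setT
      & forall i, fibrewise_homotopic_on R pX pY f g (U i)].

(* The values lie in nat extended by +oo, seen inside \bar int so that the
   order and the addition of the extended numbers apply. *)
Definition homotopic_distance (R : realType) (B X Y : topologicalType)
    (pX : X -> B) (pY : Y -> B) (f g : X -> Y) : \bar int :=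
  match pselect (exists n, `[< homotopic_cover R pX pY f g n >]) with
  | left ex => ((ex_minn ex)%:Z)%:E
  | right _ => +oo%E
  end.

(* Main.v *)
Require Import Defs.
From HB Require Import structures.
From mathcomp Require Import all_boot all_order all_algebra.
From mathcomp Require Import all_classical all_reals all_analysis.
From mathcomp Require Import lra.

Set Implicit Arguments.
Unset Strict Implicit.
Unset Printing Implicit Defensive.

Import Order.TTheory GRing.Theory Num.Theory.
Import numFieldNormedType.Exports.

Local Open Scope classical_set_scope.
Local Open Scope ring_scope.

(** Let U_0, ..., U_m be an open cover on whose members f is homotopic to h,
    and V_0, ..., V_n one on whose members h is homotopic to g. On each
    intersection of some U_i with some V_j the two homotopies can be
    concatenated, so f is homotopic to g there; but there are (m + 1)(n + 1)
    intersections, and the claim allows only m + n + 1 open sets. The gain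
    comes from the fact that homotopies on pairwise disjoint open sets glue:
    it suffices to cover X by m + n + 1 open sets, each a disjoint union of
    open sets that are contained in some intersection of U_i and V_j
    ([normal_refinement_add]).

    Normality enters through Urysohn functions. They give continuous
    functions phi_i <= 1, positive only on U_i, one of which takes the value 1
    at any given point, and likewise psi_j for the V_j. For a finite set Q of
    indices, drawn from both families together, let the peak of Q be the open
    set of points where all the functions indexed by Q are positive and
    strictly larger than all the others. Two different sets of equal size have
    disjoint peaks, since each contains an index that the other lacks. A point
    lies in the peak of the set of indices whose function is equal to 1 there,
    and this set meets both families, so it has between 2 and m + n + 2
    elements. Grouping the peaks by the size of Q gives the required
    m + n + 1 open sets.

    Homotopies over an open subset W of X are represented by total maps on
    the product of X and the interval that are continuous at the points over
    W ([fibrewise_homotopic_onP]); restricting, concatenating and gluing them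
    then involves no change of domain. *)

(** * Functions subordinate to a finite open cover of a normal space *)
(** Induction on the number of open sets. The part of C that only the last set
    U n covers is closed and contained in U n, so Urysohn's lemma yields a
    function positive only on U n and equal to 1 on a neighborhood of that
    part; what remains of C is closed and covered by the other sets. Keeping C
    general, instead of the whole space, is what makes the induction work. *)
Lemma normal_cover_functions (R : realType) (X : topologicalType) (n : nat)
    (U : nat -> set X) (C : set X) :
  normal_space X -> closed C -> (forall i, open (U i)) ->
  (forall x, C x -> exists2 i, (i < n)%N & U i x) ->
  exists phi : nat -> X -> R,
    [/\ forall i, continuous (phi i),
        forall i x, phi i x <= 1,
        forall i x, 0 < phi i x -> U i x
      & forall x, C x -> exists2 i, (i < n)%N & phi i x = 1].
Proof.
move=> nX + oU; elim: n C => [|n IH] C cC CU.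
  exists (fun _ _ => 0); split=> [i x|i x|i x|x /CU[//]].
  - exact: cvg_cst.
  - exact: ler01.
  - by rewrite ltxx.
pose V := \bigcup_(i in [set i | (i < n)%N]) U i.
have oV : open V by apply: bigcup_open.
have cUn : closed (~` U n) by apply: open_closedC.
have cA : closed (C `&` ~` V) by apply: closedI => //; apply: open_closedC.
have disj : ~` U n `&` (C `&` ~` V) = set0.
  rewrite -subset0 => x [nUx [/CU[i]]]; rewrite ltnS leq_eqVlt.
  by case/orP=> [/eqP -> //|iltn Uix]; apply; exists i.
(* The target value is 2 so that cutting u off at 1 gives a function equal to
   1 on the open set where u > 1, and not only on the given closed set. *)
have [u [cu u0 u2 _]] :=
  @urysohn_ext_itv X R nX _ _ 0 2 cUn cA disj ltac:(lra).
have oN : open [set x | 1 < u x].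
  by apply: (open_comp (f := u) (D := [set y | 1 < y]));
    [move=> x _; exact: cu|exact: open_gt].
have cC' : closed (C `&` ~` [set x | 1 < u x]).
  by apply: closedI => //; apply: open_closedC.
have [x [Cx nux]|phi [cphi phi1 phiU phiC]] := IH _ cC'.
  have [[i iltn Uix]|nVx] := pselect (V x); first by exists i.
  by exfalso; apply: nux; rewrite /= (u2 (u x)) ?ltr1n //; exists x.
exists (fun i => if i == n then fun x => Num.min (u x) 1 else phi i).
split=> [i|i x|i x|x Cx].
- case: eqP => // _ x.
  by apply: (@continuous_min R X u (fun=> 1) x); [exact: cu|exact: cvg_cst].
- by case: eqP => // _; rewrite ge_min lexx orbT.
- case: eqP => [-> ux|_]; last exact: phiU.
  apply: contrapT => nUx; move: ux.
  by rewrite (u0 (u x)) ?lt_min ?ltxx //; exists x.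
- have [ux|nux] := pselect (1 < u x).
    by exists n => //; rewrite eqxx; apply/min_idPr/ltW.
  have [i iltn phix] := phiC x (conj Cx nux); exists i; first exact: ltnW.
  by rewrite (ltn_eqF iltn).
Qed.

Lemma normal_ord_cover_functions (R : realType) (X : topologicalType) (n : nat)
    (U : 'I_n.+1 -> set X) :
  normal_space X -> (forall i, open (U i)) -> \bigcup_i U i = setT ->
  exists phi : 'I_n.+1 -> X -> R,
    [/\ forall i, continuous (phi i),
        forall i x, phi i x <= 1,
        forall i x, 0 < phi i x -> U i x
      & forall x, exists i, phi i x = 1].
Proof.
move=> nX oU covU.
have covUn x : [set: X] x -> exists2 i, (i < n.+1)%N & U (inord i) x.
  have [i _ Uix] : (\bigcup_i U i) x by rewrite covU.
  by exists i; rewrite ?inord_val.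
have [phi [cphi phi1 phiU phiT]] :=
  normal_cover_functions R nX closedT (fun i => oU (inord i)) covUn.
exists (fun i => phi i); split=> [i|i x|i x /phiU|x].
- exact: cphi.
- exact: phi1.
- by rewrite inord_val.
by have [i ilt e] := phiT x I; exists (Ordinal ilt).
Qed.

(** * Peaks of a finite family of functions *)

Section Peaks.
Context (R : realType) (X : topologicalType) (K : finType) (chi : K -> X -> R).

(** Positivity is required separately because the comparison with the indices
    outside Q says nothing when Q is the set of all indices. *)
Definition peak (Q : {set K}) : set X :=
  [set x | (forall q, q \in Q -> 0 < chi q x) /\
           (forall q r, q \in Q -> r \notin Q -> chi r x < chi q x)].

Lemma open_peak (Q : {set K}) : (forall q, continuous (chi q)) -> open (peak Q).
Proof.
move=> cchi.
have near_lt (u v : X -> R) x : continuous u -> continuous v ->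
    u x < v x -> \forall y \near x, u y < v y.
  move=> cu cv uv.
  have cw : {for x, continuous (fun y => v y - u y)}.
    by apply: (@continuousB R R^o X v u x); [exact: cv|exact: cu].
  have w0 : 0 < v x - u x by rewrite subr_gt0.
  have nw : \forall y \near x, 0 < v y - u y by exact: (cw _ (lt_nbhsr w0)).
  by near=> y; rewrite -subr_gt0; near: y.
rewrite openE => x [pos dom]; rewrite /interior.
have N1 : \forall y \near x, forall q, q \in Q -> 0 < chi q y.
  apply: filter_forall => q; case: (boolP (q \in Q)) => [qQ|_].
    have c0 : continuous ((fun=> 0) : X -> R) by move=> y; exact: cvg_cst.
    have := near_lt _ _ x c0 (cchi q) (pos q qQ).
    by move=> nq; apply: filterS nq => y yq _; exact: yq.
  exact: nearW.
have N2 : \forall y \near x, forall q r, q \in Q -> r \notin Q ->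
    chi r y < chi q y.
  apply: filter_forall => q; apply: filter_forall => r.
  case: (boolP (q \in Q)) => [qQ|_]; last exact: nearW.
  case: (boolP (r \in Q)) => [_|rQ]; first exact: nearW.
  have := near_lt _ _ x (cchi r) (cchi q) (dom q r qQ rQ).
  by move=> nqr; apply: filterS nqr => y yqr _ _.
by near=> y; split; near: y.
Unshelve. all: by end_near.
Qed.

(** Distinct sets of equal size each contain an index missing from the other;
    at a common point the two corresponding values would each be strictly
    smaller than the other. *)
Lemma peak_uniq (Q Q' : {set K}) x :
  #|Q| = #|Q'| -> peak Q x -> peak Q' x -> Q = Q'.
Proof.
move=> eqQ [_ dom] [_ dom']; apply/eqP/contraT => neQ.
have nsub (P P' : {set K}) : #|P| = #|P'| -> P != P' ->
    exists2 q, q \in P & q \notin P'.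
  move=> eqP neP; apply/subsetPn; apply: contra neP => sPP'.
  by rewrite eqEcard sPP' eqP leqnn.
have [q qQ qQ'] := nsub _ _ eqQ neQ.
have [r rQ' rQ] : exists2 r, r \in Q' & r \notin Q.
  by apply: nsub; rewrite 1?eq_sym.
by have := lt_trans (dom q r qQ rQ) (dom' r q rQ' qQ'); rewrite ltxx.
Qed.

Lemma peak_argmax x : (forall q, chi q x <= 1) ->
  peak [set q | chi q x == 1] x.
Proof.
move=> chi1; split=> [q|q r]; rewrite !inE => /eqP ->; first exact: ltr01.
by move=> ne1; rewrite lt_neqAle ne1 chi1.
Qed.

End Peaks.

(** Index the values of both families of functions by one finite set, the
    disjoint sum of the two index sets. Where a peak Q contains an index on
    either side it lies in a member of each cover. At any point the argmax Q
    does contain both kinds of index, because each family attains the common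
    maximum 1; so #|Q| runs from 2 to m + n + 2, which is m + n + 1 values,
    and peaks of equal cardinality are disjoint. *)
Lemma normal_refinement_add (R : realType) (X : topologicalType) (m n : nat)
    (U : 'I_m.+1 -> set X) (V : 'I_n.+1 -> set X) :
  normal_space X -> (forall i, open (U i)) -> \bigcup_i U i = setT ->
  (forall j, open (V j)) -> \bigcup_j V j = setT ->
  exists (D : 'I_(m + n).+1 -> set {set 'I_m.+1 + 'I_n.+1})
         (W : {set 'I_m.+1 + 'I_n.+1} -> set X),
    [/\ forall Q, open (W Q),
        forall k Q Q' x, D k Q -> D k Q' -> W Q x -> W Q' x -> Q = Q',
        forall k Q, D k Q -> exists i j, W Q `<=` U i `&` V j
      & forall x, exists k, exists2 Q, D k Q & W Q x].
Proof.
move=> nX oU covU oV covV.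
have [phi [cphi phi1 phiU phiT]] := normal_ord_cover_functions R nX oU covU.
have [psi [cpsi psi1 psiV psiT]] := normal_ord_cover_functions R nX oV covV.
pose chi (k : 'I_m.+1 + 'I_n.+1) :=
  match k with inl i => phi i | inr j => psi j end.
have cchi k : continuous (chi k) by case: k.
have chi1 k x : chi k x <= 1 by case: k => /=.
exists (fun k => [set Q : {set 'I_m.+1 + 'I_n.+1} |
  #|Q| = k.+2 /\ exists i j, inl i \in Q /\ inr j \in Q]).
exists (peak chi).
split=> [Q|k Q Q' x [cQ _] [cQ' _]|k Q [_ [i [j [iQ jQ]]]]|x].
- exact: open_peak.
- by apply: peak_uniq; rewrite cQ cQ'.
- exists i, j => x [pos _]; split.
    by apply: phiU; exact: (pos _ iQ).
  by apply: psiV; exact: (pos _ jQ).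
have [i phii] := phiT x; have [j psij] := psiT x.
pose Q := [set k | chi k x == 1]%SET.
have iQ : inl i \in Q by rewrite inE /= phii.
have jQ : inr j \in Q by rewrite inE /= psij.
have Q2 : (1 < #|Q|)%N by apply/card_gt1P; exists (inl i), (inr j).
have Qmn : (#|Q| <= (m + n).+2)%N.
  by rewrite (leq_trans (max_card _)) // card_sum !card_ord addSn addnS.
have klt : (#|Q|.-2 < (m + n).+1)%N by case: #|Q| Q2 Qmn => [|[|q]].
exists (Ordinal klt), Q; last exact: peak_argmax.
by split; [rewrite /=; case: #|Q| Q2 => [|[|q]]|exists i, j].
Qed.

(** * Reparametrizing the unit interval *)

Lemma continuous_pair (Z S T : topologicalType) (u : Z -> S) (v : Z -> T)
    (z : Z) :
  {for z, continuous u} -> {for z, continuous v} ->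
  {for z, continuous (fun z => (u z, v z))}.
Proof.
move=> cu cv P [[M N] /= [nM nN] sMN].
have {}nM : nbhs z (u @^-1` M) by exact: cu.
have {}nN : nbhs z (v @^-1` N) by exact: cv.
by apply: filterS2 nM nN => y My Ny; apply: sMN.
Qed.

Section Clamp.
Context (R : realType).

Lemma clamp_in_unit_interval (s : R) :
  Num.min (Num.max s 0) 1 \in unit_interval R.
Proof.
apply: mem_set; rewrite /unit_interval /= in_itv /=.
by rewrite le_min ler01 le_max lexx orbT /= ge_min lexx orbT.
Qed.

(** The retraction of the line onto the unit interval; it lets the
    reparametrizations t |-> 2t and t |-> 2t - 1 be written as total maps. *)
Definition clamp (s : R) : unit_interval R :=
  exist _ (Num.min (Num.max s 0) 1) (clamp_in_unit_interval s).

Lemma clamp_continuous : continuous clamp.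
Proof.
apply: continuous_comp_initial => s.
apply: (@continuous_min R R (fun s => Num.max s 0) (fun=> 1)).
  by apply: (@continuous_max R R id (fun=> 0)); [exact: cvg_id|exact: cvg_cst].
exact: cvg_cst.
Qed.

Lemma clamp_le0 (s : R) : s <= 0 -> clamp s = itv_start R.
Proof.
by move=> s0; apply: val_inj; rewrite /= (max_idPr s0); apply/min_idPl/ler01.
Qed.

Lemma clamp_ge1 (s : R) : 1 <= s -> clamp s = itv_end R.
Proof.
move=> s1; apply: val_inj => /=; apply/min_idPr.
by rewrite le_max s1.
Qed.

End Clamp.

(** * Homotopies over an open subset *)

Section OpenHomotopy.
Context (R : realType) (B X Y : topologicalType) (pX : X -> B) (pY : Y -> B).
Implicit Types (f g h : X -> Y) (W : set X).

(** G is a map on all of X, constrained only over W, so that one map can serve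
    for several open sets. *)
Definition homotopy_over f g W (G : X * unit_interval R -> Y) : Prop :=
  forall x, W x ->
    [/\ G (x, itv_start R) = f x, G (x, itv_end R) = g x,
        forall t, {for (x, t), continuous G}
      & forall t, pY (G (x, t)) = pX x].

(** Extending a homotopy by an arbitrary value (here f) outside of W keeps it
    continuous at the points over W because W is open. *)
Lemma fibrewise_homotopic_onP f g W : open W ->
  fibrewise_homotopic_on R pX pY f g W <-> exists G, homotopy_over f g W G.
Proof.
move=> oW; split=> [[H [cH H0 H1 Hp]]|[G HG]].
  exists (fun z => if pselect (W z.1) is left p
                   then H (exist _ z.1 (mem_set p), z.2) else f z.1).
  move=> x Wx; split=> [||t|t] /=.
  - by case: pselect => // p; rewrite H0.
  - by case: pselect => // p; rewrite H1.
  - move=> V /=; case: pselect => // p nV.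
    have [P [nA nT] sAT] := cH _ _ nV; case: P nA nT sAT => A T /= nA nT sAT.
    case: nA => _ [[N oN <-] /= Nx sNA].
    exists (N `&` W, T) => /=.
      split=> //; apply: open_nbhs_nbhs; split; first exact: openI.
      by split.
    move=> [y s] /= [[Ny Wy] Ts]; case: pselect => // q.
    by apply: sAT; split=> //; apply: sNA.
  - by case: pselect => // p; rewrite Hp.
have HW (u : W) : W (set_val u) by exact: set_valP.
exists (fun z => G (set_val z.1, z.2)); split=> [[u t]|u|u|u t].
- have [_ _ cG _] := HG _ (HW u).
  apply: (@continuous_comp _ _ _
    (fun z : W * unit_interval R => (set_val z.1, z.2)) G);
    last exact: cG.
  apply: continuous_pair; last exact: cvg_snd.
  apply: (@continuous_comp _ _ _ fst set_val); first exact: cvg_fst.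
  exact: initial_continuous.
- by have [-> _ _ _] := HG _ (HW u).
- by have [_ -> _ _] := HG _ (HW u).
- by have [_ _ _ ->] := HG _ (HW u).
Qed.

Lemma homotopy_over_sub f g W W' G :
  W' `<=` W -> homotopy_over f g W G -> homotopy_over f g W' G.
Proof. by move=> sW HG x /sW; exact: HG. Qed.

Lemma homotopy_over_trans f h g W G1 G2 :
  homotopy_over f h W G1 -> homotopy_over h g W G2 ->
  exists G, homotopy_over f g W G.
Proof.
move=> HG1 HG2.
pose K1 (z : X * unit_interval R) := G1 (z.1, clamp (2 * set_val z.2)).
pose K2 (z : X * unit_interval R) := G2 (z.1, clamp (2 * set_val z.2 - 1)).
pose G z := if set_val z.2 <= 2^-1 :> R then K1 z else K2 z.
have cval : continuous (fun z : X * unit_interval R => set_val z.2 : R).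
  move=> z; apply: (@continuous_comp _ _ _ snd set_val); first exact: cvg_snd.
  exact: initial_continuous.
have creparam (a b : R) : continuous (fun z : X * unit_interval R =>
    (z.1, clamp (a * set_val z.2 - b))).
  move=> [x t]; apply: continuous_pair; first exact: cvg_fst.
  apply: (@continuous_comp _ _ _
    (fun z : X * unit_interval R => a * set_val z.2 - b) (@clamp R)); last exact: clamp_continuous.
  apply: (@continuousB R R^o); last exact: cvg_cst.
  by apply: continuousM; [exact: cvg_cst|exact: cval].
exists G => x Wx.
have [G10 G11 cG1 pG1] := HG1 x Wx.
have [G20 G21 cG2 pG2] := HG2 x Wx.
have cK1 t : {for (x, t), continuous K1}.
  have -> : K1 = G1 \o (fun z => (z.1, clamp (2 * set_val z.2 - 0))).
    by apply/funext => z; rewrite /= subr0.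
  by apply: continuous_comp; [exact: creparam|exact: cG1].
have cK2 t : {for (x, t), continuous K2}.
  have -> : K2 = G2 \o (fun z => (z.1, clamp (2 * set_val z.2 - 1))) by [].
  by apply: continuous_comp; [exact: creparam|exact: cG2].
split=> [||t|t].
- by rewrite /G /K1 /= set_valE /= invr_ge0 ler0n mulr0 clamp_le0.
- rewrite /G /K2 /= set_valE /= leNgt ifF; first by rewrite clamp_ge1 //; lra.
  by apply/negbF; lra.
- have [tlt|tgt|teq] := ltgtP (set_val t : R) 2^-1.
  + have nG : \forall z \near (x, t), K1 z = G z.
      have nt := @cval (x, t) _ (lt_nbhsl tlt).
      by apply: (filterS (F := nbhs (x, t)) _ nt) => z /= zlt; rewrite /G ltW.
    move=> V nV; have {}nV : nbhs (K1 (x, t)) V by move: nV; rewrite /G /= ltW.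
    have {}nV : nbhs (x, t) (K1 @^-1` V) by exact: cK1.
    by apply: filterS2 nG nV => z /= <-.
  + have nG : \forall z \near (x, t), K2 z = G z.
      have nt := @cval (x, t) _ (lt_nbhsr tgt).
      apply: (filterS (F := nbhs (x, t)) _ nt) => z /= zgt.
      by rewrite /G leNgt zgt.
    move=> V nV; have {}nV : nbhs (K2 (x, t)) V.
      by move: nV; rewrite /G /= leNgt tgt.
    have {}nV : nbhs (x, t) (K2 @^-1` V) by exact: cK2.
    by apply: filterS2 nG nV => z /= <-.
  (* At t = 1/2 the two halves agree at (x, t), where both pass through h x.
     Nearby points need no case analysis: there G is one of K1 and K2. *)
  + have GK1 : G (x, t) = K1 (x, t) by rewrite /G /= teq lexx.
    have GK2 : G (x, t) = K2 (x, t).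
      rewrite GK1 /K1 /K2 /= teq mulfV ?pnatr_eq0 // subrr.
      by rewrite clamp_ge1 // clamp_le0 // G11 G20.
    move=> V nV.
    have nV1 : nbhs (x, t) (K1 @^-1` V) by apply: cK1; rewrite -GK1.
    have nV2 : nbhs (x, t) (K2 @^-1` V) by apply: cK2; rewrite -GK2.
    by apply: filterS2 nV1 nV2 => z V1 V2; rewrite /= /G; case: ifP.
- by rewrite /G /K1 /K2 /=; case: ifP => _; rewrite ?pG1 ?pG2.
Qed.

(** Since the W i are open and disjoint, near a point over W i the glued map
    is the homotopy chosen for i. *)
Lemma homotopy_over_bigcup_disjoint (I : Type) (D : set I) (W : I -> set X)
    f g :
  (forall i, open (W i)) ->
  (forall i j x, D i -> D j -> W i x -> W j x -> i = j) ->
  (forall i, D i -> exists G, homotopy_over f g (W i) G) ->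
  exists G, homotopy_over f g (\bigcup_(i in D) W i) G.
Proof.
move=> oW dW HW.
have /choice[G HG] : forall i, exists G, D i -> homotopy_over f g (W i) G.
  move=> i; have [/HW[G HG]|nDi] := pselect (D i); first by exists G.
  by exists (fun z => f z.1).
pose F z := if pselect (exists2 i, D i & W i z.1) is left ex
            then G (s2val (cid2 ex)) z else f z.1.
have FE i z : D i -> W i z.1 -> F z = G i z.
  move=> Di Wi; rewrite /F; case: pselect => [ex|[]]; last by exists i.
  by case: cid2 => j /= Dj Wj; rewrite (dW j i z.1).
exists F => x [i Di Wix]; have [G0 G1 cG pG] := HG i Di x Wix.
split=> [||t|t]; rewrite ?(FE i) //.
move=> V; rewrite (FE i) // => nV.
have nW : \forall z \near (x, t), W i z.1.
  by apply: (@cvg_fst _ _ (nbhs x) (nbhs t)); apply: open_nbhs_nbhs.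
have {}nV : nbhs (x, t) (G i @^-1` V) by exact: cG.
by apply: filterS2 nW nV => z Wiz Vz /=; rewrite (FE i).
Qed.

End OpenHomotopy.

(** * Subadditivity of the homotopic distance *)

Lemma homotopic_distanceP (R : realType) (B X Y : topologicalType)
    (pX : X -> B) (pY : Y -> B) (f g : X -> Y) :
  homotopic_distance R pX pY f g = +oo%E \/
  exists2 n, homotopic_distance R pX pY f g = (n%:Z)%:E
           & homotopic_cover R pX pY f g n.
Proof.
rewrite /homotopic_distance; case: pselect => [ex|_]; last by left.
by right; case: ex_minnP => n /asboolP cov _; exists n.
Qed.

Lemma homotopic_distance_le (R : realType) (B X Y : topologicalType)
    (pX : X -> B) (pY : Y -> B) (f g : X -> Y) (n : nat) :
  homotopic_cover R pX pY f g n ->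
  (homotopic_distance R pX pY f g <= (n%:Z)%:E)%E.
Proof.
move=> /asboolP cov; rewrite /homotopic_distance.
case: pselect => [ex|[]]; last by exists n.
by case: ex_minnP => m _ /(_ _ cov) mn; rewrite lee_fin lez_nat.
Qed.

Lemma homotopic_cover_add (R : realType) (B X Y : topologicalType)
    (pX : X -> B) (pY : Y -> B) (f g h : X -> Y) (m n : nat) :
  normal_space X ->
  homotopic_cover R pX pY f h m -> homotopic_cover R pX pY h g n ->
  homotopic_cover R pX pY f g (m + n).
Proof.
move=> nX [U [oU covU HU]] [V [oV covV HV]].
have [D [W [oW dW sW covW]]] := normal_refinement_add R nX oU covU oV covV.
exists (fun k => \bigcup_(Q in D k) W Q); split=> [k||k].
- by apply: bigcup_open => Q _; exact: oW.
- rewrite -subTset => x _; have [k [Q DQ WQ]] := covW x.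
  by exists k => //; exists Q.
apply/fibrewise_homotopic_onP; first by apply: bigcup_open => Q _; exact: oW.
apply: homotopy_over_bigcup_disjoint => [Q|Q Q' x|Q /sW[i [j sWij]]].
- exact: oW.
- exact: dW.
have [G1 HG1] := (fibrewise_homotopic_onP R pX pY f h (oU i)).1 (HU i).
have [G2 HG2] := (fibrewise_homotopic_onP R pX pY h g (oV j)).1 (HV j).
apply: (@homotopy_over_trans R B X Y pX pY f h g _ G1 G2).
- by apply: homotopy_over_sub HG1 => x /sWij[].
- by apply: homotopy_over_sub HG2 => x /sWij[].
Qed.

Theorem proposition4p11 (R : realType) (B X Y : topologicalType)
    (pX : X -> B) (pY : Y -> B) (f g h : X -> Y)
    (pX_continuous : continuous pX) (pY_continuous : continuous pY)
    (f_fibrewise : fibrewise_map pX pY f)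
    (g_fibrewise : fibrewise_map pX pY g)
    (h_fibrewise : fibrewise_map pX pY h)
    (X_normal : normal_space X) :
  (homotopic_distance R pX pY f g <=
     homotopic_distance R pX pY f h + homotopic_distance R pX pY h g)%E.
Proof.
have [->|[m -> covm]] := homotopic_distanceP R pX pY f h.
  by have [->|[n -> _]] := homotopic_distanceP R pX pY h g; exact: leey.
have [->|[n -> covn]] := homotopic_distanceP R pX pY h g; first exact: leey.
rewrite -EFinD -PoszD; apply: homotopic_distance_le.
exact: (homotopic_cover_add X_normal covm covn).
Qed.
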